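(* Let $\gamma=[0,+\infty[\,\subset\mathbb{R}$ and let $F\in\mathrm{Mod}(\mathbf{k}_{\mathbb{R}_{\mathfrak{a}}})$. The following are equivalent: (i) $F$ is ephemeral; (ii) the restriction morphism $\rho_{t,s}\colon F(s+\gamma)\to F(t+\gamma)$ is zero whenever $s<t$.
   Context: $\mathbf{k}$ is a field. $\mathbb{R}_{\mathfrak{a}}$ is $\mathbb{R}$ with the Alexandrov topology associated with $\gamma=[0,+\infty[$: the open sets are all subsets $U\subset\mathbb{R}$ with $U+\gamma=U$. $\mathbb{R}_\gamma$ is $\mathbb{R}$ with the $\gamma$-topology: the open sets are the usual open subsets $U$ with $U+\gamma=U$. $\mathrm{Mod}(\mathbf{k}_X)$ is the category of sheaves of $\mathbf{k}$-modules on $X$. $\beta\colon\mathbb{R}_{\mathfrak a}\to\mathbb{R}_\gamma$ is the identity map, which is continuous. A sheaf $F\in\mathrm{Mod}(\mathbf{k}_{\mathbb{R}_{\mathfrak{a}}})$ is ephemeral if $\beta_*F\simeq0$, i.e. $F(U)=0$ for every $\gamma$-open set $U$. *)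

(* Defs.v *)
From HB Require Import structures.
From mathcomp Require Import all_boot all_order all_algebra.
From mathcomp Require Import boolp classical_sets reals set_interval topology.
From mathcomp Require Import normedtype.

Set Implicit Arguments.
Unset Strict Implicit.
Unset Printing Implicit Defensive.

Import Order.TTheory GRing.Theory Num.Theory.
Import numFieldNormedType.Exports.

Local Open Scope classical_set_scope.
Local Open Scope ring_scope.

Record opens (X : topologicalType) := Opens {
  opens_set :> set X;
  opens_open : open opens_set
}.

Definition opens_meet (X : topologicalType) (U V : opens X) : opens X :=
  Opens (openI (opens_open U) (opens_open V)).

Record presheaf (k : fieldType) (X : topologicalType) := Presheaf {
  sections :> opens X -> lmodType k;
  restr : forall U V : opens X,
    V `<=` U -> {linear sections U -> sections V};
  restr_id : forall (U : opens X) (h : U `<=` U) (s : sections U),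
    restr h s = s;
  restr_comp : forall (U V W : opens X) (hVU : V `<=` U) (hWV : W `<=` V)
    (hWU : W `<=` U) (s : sections U),
    restr hWV (restr hVU s) = restr hWU s
}.

(* The index type [I] may be empty, so that sections over the empty set
   are trivial. *)
Definition is_sheaf (k : fieldType) (X : topologicalType)
    (F : presheaf k X) : Prop :=
  forall (I : Type) (U : opens X) (V : I -> opens X)
    (hV : forall i, V i `<=` U), U `<=` \bigcup_i V i ->
  forall s : forall i, F (V i),
    (forall i j,
      restr F (@subIsetl _ (V i) (V j) : opens_meet (V i) (V j) `<=` V i) (s i)
      = restr F (@subIsetr _ (V i) (V j) : opens_meet (V i) (V j) `<=` V j)
          (s j)) ->
  exists! t : F U, forall i, restr F (hV i) t = s i.

Record sheaf (k : fieldType) (X : topologicalType) := Sheaf {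
  sheaf_presheaf :> presheaf k X;
  sheafP : is_sheaf sheaf_presheaf
}.

Record sheaf_hom (k : fieldType) (X : topologicalType) (F G : sheaf k X) :=
  SheafHom {
    hom_sections :> forall U : opens X, {linear F U -> G U};
    hom_natural : forall (U V : opens X) (h : V `<=` U) (s : F U),
      hom_sections V (restr F h s) = restr G h (hom_sections U s)
  }.

Definition sheaf_isomorphic (k : fieldType) (X : topologicalType)
    (F G : sheaf k X) : Prop :=
  exists (f : sheaf_hom F G) (g : sheaf_hom G F),
    forall U : opens X, cancel (f U) (g U) /\ cancel (g U) (f U).

Section zero_sheaf.
Variables (k : fieldType) (X : topologicalType).

Definition zero_presheaf : presheaf k X :=
  @Presheaf k X (fun=> 'rV[k]_0 : lmodType k) (fun _ _ _ => idfun)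
    (fun _ _ _ => erefl) (fun _ _ _ _ _ _ _ => erefl).

Lemma zero_presheaf_is_sheaf : is_sheaf zero_presheaf.
Proof.
move=> I U V hV cov s _; exists 0; split => [i|t _].
  by rewrite [LHS]thinmx0 [RHS]thinmx0.
by rewrite [RHS]thinmx0.
Qed.

Definition zero_sheaf : sheaf k X := Sheaf zero_presheaf_is_sheaf.

End zero_sheaf.

Section direct_image.
Variables (k : fieldType) (X Y : topologicalType) (f : X -> Y).
Hypothesis cf : continuous f.

Definition opens_preimage (U : opens Y) : opens X :=
  @Opens X (f @^-1` U) (proj1 (continuousP f) cf U (opens_open U)).

Variable F : sheaf k X.

Definition direct_image_presheaf : presheaf k Y :=
  @Presheaf k Y (fun U => F (opens_preimage U))
    (fun U V (h : V `<=` U) =>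
       @restr k X F (opens_preimage U) (opens_preimage V)
         (fun x => h (f x)))
    (fun U _ s => restr_id _ s)
    (fun U V W _ _ _ s => restr_comp _ _ _ s).

Lemma direct_image_is_sheaf : is_sheaf direct_image_presheaf.
Proof.
move=> I U V hV cov s comp.
apply: (@sheafP k X F I (opens_preimage U) (fun i => opens_preimage (V i))
  (fun i x => hV i (f x))) => [x Ux|i j].
  by have [i _ Vi] := cov _ Ux; exists i.
have := comp i j; rewrite /=.
set a := restr F _ _; set b := restr F _ _ => ab.
pose W := opens_meet (opens_preimage (V i)) (opens_preimage (V j)).
have hW : W `<=` opens_preimage (opens_meet (V i) (V j)) by [].
have := congr1 (restr F hW) ab; rewrite /a /b.
by rewrite !(restr_comp _ _ (@subIsetl _ _ _ : W `<=` _))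
  !(restr_comp _ _ (@subIsetr _ _ _ : W `<=` _)).
Qed.

Definition direct_image : sheaf k Y := Sheaf direct_image_is_sheaf.

End direct_image.

Section gamma.
Variable R : realType.

Definition gamma : set R := `[0, +oo[.

Definition set_add (A B : set R) : set R := [set x + y | x in A & y in B].

Definition translate (t : R) (A : set R) : set R := [set t + x | x in A].

Lemma gammaE (x : R) : gamma x = (0 <= x) :> Prop.
Proof. by rewrite /gamma /= in_itv /= andbT. Qed.

Lemma set_add_gammaP (U : set R) :
  set_add U gamma = U <-> (forall x y, U x -> x <= y -> U y).
Proof.
rewrite /set_add /gamma; split => [e x y Ux xy|h].
  rewrite -e; exists x => //; exists (y - x); last by rewrite addrC subrK.
  by rewrite /= in_itv /= andbT subr_ge0.
apply/seteqP; split => [_ [x Ux [y + <-]]|x Ux].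
  by rewrite /= in_itv /= andbT => y0; apply: (h x) => //; rewrite lerDl.
by exists x => //; exists 0; rewrite ?addr0 //= in_itv /= lexx.
Qed.

Lemma set_add_gammaT : set_add setT gamma = setT.
Proof. exact/set_add_gammaP. Qed.

Lemma set_add_gammaI (U V : set R) :
  set_add U gamma = U -> set_add V gamma = V ->
  set_add (U `&` V) gamma = U `&` V.
Proof.
move=> /set_add_gammaP hU /set_add_gammaP hV; apply/set_add_gammaP.
by move=> x y [Ux Vx] xy; split; [exact: hU xy|exact: hV xy].
Qed.

Lemma set_add_gamma_bigU (I : Type) (f : I -> set R) :
  (forall i, set_add (f i) gamma = f i) ->
  set_add (\bigcup_i f i) gamma = \bigcup_i f i.
Proof.
move=> h; apply/set_add_gammaP => x y [i _ fx] xy; exists i => //.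
by move/set_add_gammaP: (h i); apply; [exact: fx|].
Qed.

Lemma set_add_translate_gamma (t : R) :
  set_add (translate t gamma) gamma = translate t gamma.
Proof.
apply/set_add_gammaP => _ y [z + <-] ty.
rewrite /gamma /= in_itv /= andbT => z0; exists (y - t); last first.
  by rewrite addrC subrK.
by rewrite /= in_itv /= andbT subr_ge0 (le_trans _ ty) // lerDl.
Qed.

End gamma.

(* Aliases of [R], which receive below topologies different from the usual
   one. *)
Definition alexandrov_line (R : realType) : Type := R.
Definition gamma_line (R : realType) : Type := R.

Section topologies.
Variable R : realType.

Definition alexandrov_open : set_system (alexandrov_line R) :=
  [set U : set R | set_add U (@gamma R) = U].

(* [U] is typed in [R], so that [open U] refers to the usual topology. *)
Definition gamma_open : set_system (gamma_line R) :=
  [set U : set R | open U /\ set_add U (@gamma R) = U].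

HB.instance Definition _ := Choice.on (alexandrov_line R).
HB.instance Definition _ := Choice.on (gamma_line R).

Fact alexandrov_openT : alexandrov_open setT.
Proof. exact: set_add_gammaT. Qed.

Fact alexandrov_openI : setI_closed alexandrov_open.
Proof. exact: set_add_gammaI. Qed.

Fact alexandrov_open_bigU (I : Type) (f : I -> set (alexandrov_line R)) :
  (forall i, alexandrov_open (f i)) -> alexandrov_open (\bigcup_i f i).
Proof. exact: set_add_gamma_bigU. Qed.

HB.instance Definition _ := isOpenTopological.Build (alexandrov_line R)
  alexandrov_openT alexandrov_openI alexandrov_open_bigU.

Fact gamma_openT : gamma_open setT.
Proof. by split; [exact: openT|exact: set_add_gammaT]. Qed.

Fact gamma_openI : setI_closed gamma_open.
Proof.
by move=> U V [oU gU] [oV gV]; split; [exact: openI|exact: set_add_gammaI].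
Qed.

Fact gamma_open_bigU (I : Type) (f : I -> set (gamma_line R)) :
  (forall i, gamma_open (f i)) -> gamma_open (\bigcup_i f i).
Proof.
move=> h; split; first by apply: bigcup_open => i _; exact: (h i).1.
by apply: set_add_gamma_bigU => i; exact: (h i).2.
Qed.

HB.instance Definition _ := isOpenTopological.Build (gamma_line R)
  gamma_openT gamma_openI gamma_open_bigU.

Lemma alexandrov_lineE (U : set (alexandrov_line R)) :
  open U = alexandrov_open U.
Proof. by []. Qed.

Lemma gamma_lineE (U : set (gamma_line R)) : open U = gamma_open U.
Proof. by []. Qed.

Definition beta : alexandrov_line R -> gamma_line R := fun x => x.

Lemma beta_continuous : continuous beta.
Proof.
by apply/continuousP => U; rewrite gamma_lineE alexandrov_lineE => -[].
Qed.

Lemma translate_gamma_open (t : R) :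
  open (translate t (@gamma R) : set (alexandrov_line R)).
Proof. by rewrite alexandrov_lineE; exact: set_add_translate_gamma. Qed.

Definition shifted_gamma (t : R) : opens (alexandrov_line R) :=
  Opens (translate_gamma_open t).

Lemma shifted_gamma_sub (s t : R) :
  s <= t -> shifted_gamma t `<=` shifted_gamma s.
Proof.
move=> st _ [x gx <-]; exists (t - s + x); last first.
  by rewrite addrA (addrC s) subrK.
by move: gx; rewrite !gammaE => x0; rewrite addr_ge0 // subr_ge0.
Qed.

End topologies.

Section ephemeral.
Variables (k : fieldType) (R : realType) (F : sheaf k (alexandrov_line R)).

Definition ephemeral : Prop :=
  sheaf_isomorphic (direct_image (@beta_continuous R) F)
    (zero_sheaf k (gamma_line R)).

Definition rho (t s : R) (st : s <= t) :
    {linear F (shifted_gamma s) -> F (shifted_gamma t)} :=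
  restr F (shifted_gamma_sub st).

Lemma ephemeralP :
  ephemeral <->
  forall (U : opens (gamma_line R))
    (x : F (opens_preimage (@beta_continuous R) U)), x = 0.
Proof.
split => [[f [g fg]] U x|F0].
  have [/(_ x) fK _] := fg U.
  by rewrite -fK [f U x]thinmx0 raddf0.
pose G := direct_image (@beta_continuous R) F.
pose Z := zero_sheaf k (gamma_line R).
have nf (U V : opens (gamma_line R)) (h : V `<=` U) (s : G U) :
    (\0 : {linear G V -> Z V}) (restr G h s) =
    restr Z h ((\0 : {linear G U -> Z U}) s) by rewrite /= .
have ng (U V : opens (gamma_line R)) (h : V `<=` U) (s : Z U) :
    (\0 : {linear Z V -> G V}) (restr Z h s) =
    restr G h ((\0 : {linear Z U -> G U}) s) by rewrite /= raddf0.
exists (SheafHom nf), (SheafHom ng) => U; split => x.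
  by rewrite [RHS]F0.
by rewrite [LHS]thinmx0 [RHS]thinmx0.
Qed.

End ephemeral.

(* Main.v *)
Require Import Defs.
From mathcomp Require Import all_boot all_order all_algebra.
From mathcomp Require Import boolp classical_sets reals topology.
From mathcomp Require Import normedtype.
Import Order.TTheory GRing.Theory Num.Theory.
Import numFieldNormedType.Exports.
Local Open Scope ring_scope.

(** The half-lines [t + gamma] form a basis of the Alexandrov topology, and a
    gamma-open set fits between any two of them: if [s < t], then [t + gamma]
    lies in the gamma-open set [`]s, +oo[], which lies in [s + gamma].  An
    ephemeral sheaf has no nonzero section on that set, so the restriction from
    [s + gamma] to [t + gamma] factors through zero.

    Conversely, a gamma-open set [U] contains with each point [t] a point
    [s < t], because it is open for the usual topology, hence it contains
    [s + gamma], because it is stable under addition of [gamma].  The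
    restriction of a section on [U] to [t + gamma] therefore passes through
    [s + gamma], and vanishes when the maps [rho] do.  As [U] is the union of
    the sets [t + gamma] for [t] in [U], the section is zero by locality
    ([sheaf_locality]). *)

Lemma sheaf_locality {k : fieldType} {X : topologicalType} (F : sheaf k X)
    (I : Type) (U : opens X) (V : I -> opens X)
    (VU : forall i, (V i `<=` U)%classic) (x : F U) :
  (U `<=` \bigcup_i V i)%classic ->
  (forall i, restr F (VU i) x = 0) -> x = 0.
Proof.
move=> cover x0.
have [|y [_ y_uniq]] := @sheafP k X F I U V VU cover (fun=> 0).
  by move=> i j; rewrite !raddf0.
by rewrite -(y_uniq x x0) (y_uniq 0) // => i; rewrite raddf0.
Qed.

Section half_lines.
Variable R : realType.
Implicit Types (s t y : R).

Lemma shifted_gammaP t y : opens_set (shifted_gamma t) y <-> t <= y.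
Proof.
split => [[z + <-]|ty]; first by rewrite gammaE lerDl.
by exists (y - t); rewrite ?gammaE ?subr_ge0 // addrC subrK.
Qed.

Lemma gamma_open_ray s : open ([set y : R | s < y]%classic : set (gamma_line R)).
Proof.
rewrite gamma_lineE; split; first exact: open_gt.
by apply/set_add_gammaP => y z; exact: lt_le_trans.
Qed.

Definition open_ray s : opens (gamma_line R) := Opens (gamma_open_ray s).

Lemma gamma_open_up (U : opens (gamma_line R)) s :
  opens_set U s -> (shifted_gamma s `<=` U)%classic.
Proof.
have [_ /set_add_gammaP upU] := opens_open U.
by move=> Us y /shifted_gammaP; exact: upU.
Qed.

Lemma gamma_open_lt (U : opens (gamma_line R)) t :
  opens_set U t -> exists2 s, s < t & opens_set U s.
Proof.
have [oU _] := opens_open U => Ut.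
have /nbhs_ballP[e /= e0 eU] : nbhs t (U : set R) by exact: open_nbhs_nbhs.
(* Half the radius, since the ball is open. *)
exists (t - e / 2); first by rewrite ltrBlDr ltrDl divr_gt0.
apply: eU; rewrite /ball /= subKr gtr0_norm ?divr_gt0 //.
by rewrite ltr_pdivrMr // ltr_pMr // ltr1n.
Qed.

End half_lines.

Theorem lemma3p7 (k : fieldType) (R : realType)
    (F : sheaf k (alexandrov_line R)) :
  ephemeral F <->
  (forall (s t : R) (st : s < t) (x : F (shifted_gamma s)),
     rho F (ltW st) x = 0).
Proof.
rewrite ephemeralP; split => [F0 s t st x|rho0 U x].
  pose W := opens_preimage (@beta_continuous R) (open_ray _ s).
  have Ws : (W `<=` shifted_gamma s)%classic.
    by move=> y sy; apply/shifted_gammaP/ltW.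
  have tW : (shifted_gamma t `<=` W)%classic.
    by move=> y /shifted_gammaP; exact: lt_le_trans.
  by rewrite /rho -(restr_comp Ws tW) [restr _ Ws x]F0 raddf0.
have VU (i : {t : R | opens_set U t}) : (shifted_gamma (sval i) `<=`
    opens_preimage (@beta_continuous R) U)%classic.
  exact: gamma_open_up (svalP i).
apply: (sheaf_locality F _ _ _ VU) => [t Ut|[t Ut]].
  by exists (exist _ t Ut) => //; apply/shifted_gammaP.
have [s st Us] := gamma_open_lt _ _ _ Ut.
have sU : (shifted_gamma s `<=` opens_preimage (@beta_continuous R) U)%classic.
  exact: gamma_open_up.
by rewrite -(restr_comp sU (shifted_gamma_sub (ltW st))); exact: rho0.
Qed.
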